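(* Let $\mathcal{G}=(\mathcal{V},\mathcal{E})$ be an undirected graph with $n$ nodes, $m$ edges and adjacency matrix $\mathbf{A}\in\{0,1\}^{n\times n}$. Let $\hat{\mathbf{A}}=\mathbf{A}+\mathbf{I}$, let $\hat{\mathbf{D}}$ be the diagonal matrix with $\hat{\mathbf{D}}_{ii}=\sum_j\hat{\mathbf{A}}_{ij}$, let $\tilde{\mathbf{A}}=\hat{\mathbf{D}}^{-1/2}\hat{\mathbf{A}}\hat{\mathbf{D}}^{-1/2}$ and $\tilde{\mathbf{L}}=\mathbf{I}-\tilde{\mathbf{A}}$. Let $\Delta\in\{-1,0,1\}^{m\times n}$ be an oriented incidence matrix of $\mathcal{G}$ (for the $\ell$-th edge $e_\ell=(i,j)$, the $\ell$-th row of $\Delta$ has $-1$ in column $i$, $+1$ in column $j$, and $0$ elsewhere, with arbitrary orientation), and let $\tilde{\Delta}=\Delta\hat{\mathbf{D}}^{-1/2}$. Fix $\mathbf{X}_{\mathrm{in}}\in\mathbb{R}^{n\times d}$ and $\lambda_1,\lambda_2\ge 0$, and let $$f(\mathbf{F})=\frac{\lambda_2}{2}\operatorname{tr}(\mathbf{F}^\top\tilde{\mathbf{L}}\mathbf{F})+\frac12\|\mathbf{F}-\mathbf{X}_{\mathrm{in}}\|_F^2 .$$ Consider the two problems $$\text{(Option I)}\quad \min_{\mathbf{F}\in\mathbb{R}^{n\times d}} \lambda_1\|\tilde{\Delta}\mathbf{F}\|_1+f(\mathbf{F}),\qquad \text{(Option II)}\quad \min_{\mathbf{F}\in\mathbb{R}^{n\times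 d}} \lambda_1\|\tilde{\Delta}\mathbf{F}\|_{21}+f(\mathbf{F}),$$ where $\|\mathbf{X}\|_1=\sum_{ij}|\mathbf{X}_{ij}|$ and $\|\mathbf{X}\|_{21}=\sum_i\|\mathbf{X}_i\|_2$ ($\mathbf{X}_i$ the $i$-th row). Let $\gamma,\beta>0$ and define the elastic message passing iteration, starting from $\mathbf{F}^0=\mathbf{X}_{\mathrm{in}}$ and $\mathbf{Z}^0=\mathbf{0}\in\mathbb{R}^{m\times d}$, by $$\mathbf{Y}^{k}=\mathbf{F}^k-\gamma\nabla f(\mathbf{F}^k)=\big((1-\gamma)\mathbf{I}-\gamma\lambda_2\tilde{\mathbf{L}}\big)\mathbf{F}^k+\gamma\mathbf{X}_{\mathrm{in}},$$ $$\bar{\mathbf{F}}^{k+1}=\mathbf{Y}^k-\gamma\tilde{\Delta}^\top\mathbf{Z}^k,\qquad \bar{\mathbf{Z}}^{k+1}=\mathbf{Z}^k+\beta\tilde{\Delta}\bar{\mathbf{F}}^{k+1},$$ $$\mathbf{Z}^{k+1}=\begin{cases}\text{(Option I)}\ \ \mathbf{Z}^{k+1}_{ij}=\operatorname{sign}(\bar{\mathbf{Z}}^{k+1}_{ij})\min(|\bar{\mathbf{Z}}^{k+1}_{ij}|,\lambda_1)\ \text{for all } i,j,\\[2pt] \text{(Option II)}\ \ \mathbf{Z}^{k+1}_i=\min(\|\bar{\mathbf{Z}}^{k+1}_i\|_2,\lambda_1)\,\dfrac{\bar{\mathbf{Z}}^{k+1}_i}{\|\bar{\mathbf{Z}}^{k+1}_i\|_2}\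 \text{for all } i\in[m]\ (\text{taken as }\mathbf{0}\text{ if }\bar{\mathbf{Z}}^{k+1}_i=\mathbf{0}),\end{cases}$$ $$\mathbf{F}^{k+1}=\mathbf{Y}^k-\gamma\tilde{\Delta}^\top\mathbf{Z}^{k+1}.$$ If $\gamma<\frac{2}{1+\lambda_2\|\tilde{\mathbf{L}}\|_2}$ and $\beta\le\frac{4}{3\gamma\|\tilde{\Delta}\tilde{\Delta}^\top\|_2}$, then $\mathbf{F}^k$ converges to the optimal solution of the Option I problem (when Option I is used in the iteration) or of the Option II problem (when Option II is used). Moreover, $\|\tilde{\mathbf{L}}\|_2=\|\tilde{\Delta}^\top\tilde{\Delta}\|_2=\|\tilde{\Delta}\tilde{\Delta}^\top\|_2\le 2$, so it is sufficient to choose any $\gamma<\frac{2}{1+2\lambda_2}$ and $\beta\le\frac{2}{3\gamma}$.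
   Context: $\|\cdot\|_2$ of a matrix denotes its largest singular value; $\|\cdot\|_F$ is the Frobenius norm. With the specific choice $\gamma=1/(1+\lambda_2)$ the step $\mathbf{Y}^k$ simplifies to $\gamma\mathbf{X}_{\mathrm{in}}+(1-\gamma)\tilde{\mathbf{A}}\mathbf{F}^k$, which is the form used in the paper's figure defining the scheme. *)

(* Defs.v *)
From HB Require Import structures.
From mathcomp Require Import all_boot all_order all_algebra.
From mathcomp Require Import all_classical all_reals all_analysis.
Set Implicit Arguments. Unset Strict Implicit. Unset Printing Implicit Defensive.
Import Order.TTheory GRing.Theory Num.Theory.
Local Open Scope ring_scope.
Local Open Scope classical_set_scope.

Section EMP.
Variable R : realType.

Definition spec_norm p q (M : 'M[R]_(p, q)) : R :=
  Num.sqrt (sup [set a : R | eigenvalue (M^T *m M) a]).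

Definition frob_norm p q (M : 'M[R]_(p, q)) : R :=
  Num.sqrt (\sum_i \sum_j M i j ^+ 2).

Definition norm1 p q (M : 'M[R]_(p, q)) : R := \sum_i \sum_j `|M i j|.

Definition row_norm p q (M : 'M[R]_(p, q)) (i : 'I_p) : R :=
  Num.sqrt (\sum_j M i j ^+ 2).

Definition norm21 p q (M : 'M[R]_(p, q)) : R := \sum_i row_norm M i.

Variables (n m : nat) (e : 'I_m -> 'I_n * 'I_n).

Definition adj : 'M[R]_n :=
  \matrix_(i, j) (if [exists l, (e l == (i, j)) || (e l == (j, i))] then 1 else 0).

Definition Ahat : 'M[R]_n := adj + 1%:M.
Definition deghat (i : 'I_n) : R := \sum_j Ahat i j.
Definition Dhat_isqrt : 'M[R]_n := \matrix_(i, j) (if i == j then (Num.sqrt (deghat i))^-1 else 0).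
Definition Atilde : 'M[R]_n := Dhat_isqrt *m Ahat *m Dhat_isqrt.
Definition Ltilde : 'M[R]_n := 1%:M - Atilde.

Definition incid : 'M[R]_(m, n) :=
  \matrix_(l, k) ((if k == (e l).2 then 1 else 0) - (if k == (e l).1 then 1 else 0)).
Definition Dtilde : 'M[R]_(m, n) := incid *m Dhat_isqrt.

Variables (d : nat) (Xin : 'M[R]_(n, d)) (lam1 lam2 : R).

Definition fsmooth (F : 'M[R]_(n, d)) : R :=
  lam2 / 2 * \tr (F^T *m Ltilde *m F) + 1 / 2 * frob_norm (F - Xin) ^+ 2.

Inductive option_kind := OptI | OptII.

Definition objective (o : option_kind) (F : 'M[R]_(n, d)) : R :=
  match o with
  | OptI => lam1 * norm1 (Dtilde *m F) + fsmooth F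
  | OptII => lam1 * norm21 (Dtilde *m F) + fsmooth F
  end.

Definition prox (o : option_kind) (Zb : 'M[R]_(m, d)) : 'M[R]_(m, d) :=
  match o with
  | OptI => \matrix_(i, j) (Num.sg (Zb i j) * Num.min `|Zb i j| lam1)
  | OptII => \matrix_(i, j)
       (if row_norm Zb i == 0 then 0
        else Num.min (row_norm Zb i) lam1 * (Zb i j / row_norm Zb i))
  end.

Variables (gamma beta : R).

Definition emp_step (o : option_kind) (FZ : 'M[R]_(n, d) * 'M[R]_(m, d)) :=
  let (F, Z) := FZ in
  let Y := ((1 - gamma)%:M - (gamma * lam2) *: Ltilde) *m F + gamma *: Xin in
  let Fb := Y - gamma *: (Dtilde^T *m Z) in
  let Zb := Z + beta *: (Dtilde *m Fb) in
  let Z' := prox o Zb in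
  (Y - gamma *: (Dtilde^T *m Z'), Z').

Fixpoint emp_iter (o : option_kind) (k : nat) : 'M[R]_(n, d) * 'M[R]_(m, d) :=
  match k with
  | 0 => (Xin, 0)
  | k'.+1 => emp_step o (emp_iter o k')
  end.

Definition emp_F (o : option_kind) (k : nat) : 'M[R]_(n, d) := (emp_iter o k).1.

End EMP.

(* simple undirected graph given by an edge list (one orientation per edge) *)
Definition simple_edges n m (e : 'I_m -> 'I_n * 'I_n) : Prop :=
  (forall l, (e l).1 != (e l).2) /\
  (forall l l', l != l' -> e l' != e l /\ e l' != ((e l).2, (e l).1)).

(* Main.v *)
Require Import Defs.
From HB Require Import structures.
From mathcomp Require Import all_boot all_order all_algebra.
From mathcomp Require Import all_classical all_reals all_analysis.
From mathcomp Require Import ring lra.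
Set Implicit Arguments. Unset Strict Implicit. Unset Printing Implicit Defensive.
Import Order.TTheory GRing.Theory Num.Theory numFieldNormedType.Exports.
Local Open Scope ring_scope.
Local Open Scope classical_set_scope.

(* Write B for the normalized incidence matrix, L = B^T B for the normalized
   Laplacian, H = I + lam2 L for the Hessian of the smooth part and g for the
   regularizer, whose conjugate is the indicator of a compact convex set C; the
   Z-update projects onto C.  Minimizing the quadratic dual objective over C
   gives a saddle point (x, z): H x = Xin - B^T z with z in C and
   <B x, z> = g(B x).  Strong convexity makes x the unique minimizer.  For the
   errors dx, dz of an iterate, the energy
     beta |dx|^2 + gamma |dz|^2 - (beta gamma^2 / 2) |B^T dz|^2
   dominates beta |dx|^2 when gamma beta |B B^T| <= 4/3, and the variational
   inequality of the projection shows that it decreases by at least a fixed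
   multiple of |dx|^2 at each step.  Hence dx tends to 0, without any
   information on the convergence of the dual iterates. *)

(** * Frobenius inner product of matrices *)

Definition dot {R : realType} {p q : nat} (A B : 'M[R]_(p, q)) : R :=
  \sum_i \sum_j A i j * B i j.

Section Dot.
Context {R : realType}.

Lemma dotC p q (A B : 'M[R]_(p, q)) : dot A B = dot B A.
Proof. by apply: eq_bigr => i _; apply: eq_bigr => j _; rewrite mulrC. Qed.

Lemma dotDr p q (A B C : 'M[R]_(p, q)) : dot A (B + C) = dot A B + dot A C.
Proof.
rewrite -big_split; apply: eq_bigr => i _; rewrite -big_split.
by apply: eq_bigr => j _; rewrite mxE mulrDr.
Qed.

Lemma dotDl p q (A B C : 'M[R]_(p, q)) : dot (A + B) C = dot A C + dot B C.
Proof. by rewrite dotC dotDr ![dot C _]dotC. Qed.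

Lemma dotZr p q c (A B : 'M[R]_(p, q)) : dot A (c *: B) = c * dot A B.
Proof.
rewrite mulr_sumr; apply: eq_bigr => i _; rewrite mulr_sumr.
by apply: eq_bigr => j _; rewrite mxE mulrCA.
Qed.

Lemma dotZl p q c (A B : 'M[R]_(p, q)) : dot (c *: A) B = c * dot A B.
Proof. by rewrite dotC dotZr dotC. Qed.

Lemma dotNr p q (A B : 'M[R]_(p, q)) : dot A (- B) = - dot A B.
Proof. by rewrite -scaleN1r dotZr mulN1r. Qed.

Lemma dotNl p q (A B : 'M[R]_(p, q)) : dot (- A) B = - dot A B.
Proof. by rewrite dotC dotNr dotC. Qed.

Lemma dot0r p q (A : 'M[R]_(p, q)) : dot A 0 = 0.
Proof. by rewrite -(scale0r A) dotZr mul0r. Qed.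

Definition dotE := (@dotDr, @dotDl, @dotNr, @dotNl, @dotZr, @dotZl).

Lemma dotvv_ge0 p q (A : 'M[R]_(p, q)) : 0 <= dot A A.
Proof. by do 2![apply: sumr_ge0 => ? _]; rewrite -expr2 sqr_ge0. Qed.

Lemma sqr_entry_le_dot p q (A : 'M[R]_(p, q)) i j : A i j ^+ 2 <= dot A A.
Proof.
rewrite /dot (bigD1 i) // (bigD1 j) //= -expr2 -addrA lerDl.
rewrite addr_ge0 //; first by apply: sumr_ge0 => ? _; rewrite -expr2 sqr_ge0.
by do 2![apply: sumr_ge0 => ? _]; rewrite -expr2 sqr_ge0.
Qed.

Lemma dotvv_eq0 p q (A : 'M[R]_(p, q)) : dot A A = 0 -> A = 0.
Proof.
move=> A0; apply/matrixP => i j; apply/eqP; rewrite mxE -sqrf_eq0.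
by rewrite eq_le sqr_ge0 -A0 sqr_entry_le_dot.
Qed.

Lemma dot_mull p q r (M : 'M[R]_(p, q)) (A : 'M[R]_(q, r)) (B : 'M[R]_(p, r)) :
  dot (M *m A) B = dot A (M^T *m B).
Proof.
rewrite /dot.
transitivity (\sum_i \sum_j \sum_k M i k * A k j * B i j).
  by do 2![apply: eq_bigr => ? _]; rewrite mxE mulr_suml.
transitivity (\sum_k \sum_j \sum_i M i k * A k j * B i j).
  rewrite exchange_big /= [RHS]exchange_big; apply: eq_bigr => j _ /=.
  by rewrite exchange_big.
apply: eq_bigr => k _; apply: eq_bigr => j _; rewrite mxE mulr_sumr.
by apply: eq_bigr => i _; rewrite mxE; ring.
Qed.

Lemma dot_sqr_le p q (A B : 'M[R]_(p, q)) : dot A B ^+ 2 <= dot A A * dot B B.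
Proof.
have [B0|B0] := eqVneq (dot B B) 0.
  rewrite (dotvv_eq0 B0) -(scale0r (0 : 'M[R]_(p, q))).
  by rewrite !dotZr !mul0r mulr0 expr0n.
have Bp : 0 < dot B B by rewrite lt_def B0 dotvv_ge0.
have := dotvv_ge0 (dot B B *: A - dot A B *: B).
rewrite !dotE (dotC B A) => H.
by rewrite -subr_ge0 -(pmulr_rge0 _ Bp); lra.
Qed.

(** Cauchy-Schwarz for a semidefinite form: the quadratic t -> <A + tB, S(A + tB)> is nonnegative,
    so its discriminant is not positive. *)
Lemma psd_sqr_le p q (S : 'M[R]_p) (A B : 'M[R]_(p, q)) : S^T = S ->
  (forall V : 'M[R]_(p, q), 0 <= dot V (S *m V)) ->
  dot A (S *m B) ^+ 2 <= dot A (S *m A) * dot B (S *m B).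
Proof.
move=> Ssym Spos.
have sym (U V : 'M[R]_(p, q)) : dot U (S *m V) = dot V (S *m U).
  by rewrite [LHS]dotC dot_mull Ssym.
have quad t : 0 <= dot A (S *m A) + 2 * t * dot A (S *m B)
                     + t ^+ 2 * dot B (S *m B).
  have := Spos (A + t *: B); rewrite !mulmxDr -!scalemxAr !dotE (sym B A).
  lra.
have a0 := Spos A; have c0 := Spos B.
move: (dot A (S *m A)) (dot A (S *m B)) (dot B (S *m B)) quad a0 c0.
move=> a b c quad a0 c0.
have [c00|c00] := eqVneq c 0.
  have [->|b0] := eqVneq b 0; first by rewrite expr0n c00 mulr0.
  (* When c = 0 the quadratic is affine in t; this t would give it the value -1. *)
  have := quad (- (a + 1) / (2 * b)); rewrite c00 mulr0 addr0.
  have -> : 2 * (- (a + 1) / (2 * b)) * b = - (a + 1) by field.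
  lra.
have cp : 0 < c by rewrite lt_def c00.
(* The minimizer of the quadratic. *)
have := quad (- b / c).
have -> : a + 2 * (- b / c) * b + (- b / c) ^+ 2 * c = (a * c - b ^+ 2) / c.
  by field.
by rewrite pmulr_lge0 ?invr_gt0 // subr_ge0.
Qed.

(** A crude finite bound is enough for the later suprema and infima. Row-by-column Cauchy-Schwarz
    gives |MV|^2 <= |M|^2 |V|^2, and 2<V, MV> <= |V|^2 + |MV|^2. *)
Lemma dot_mulmx_bounded p q (M : 'M[R]_p) :
  exists2 c, 0 < c & forall V : 'M[R]_(p, q),
    dot V (M *m V) <= c * dot V V.
Proof.
exists (1 + dot M M); first by rewrite ltr_pwDl // dotvv_ge0.
move=> V.
have MV : dot (M *m V) (M *m V) <= dot M M * dot V V.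
  have -> : dot (M *m V) (M *m V) =
            \sum_i \sum_j dot (row i M)^T (col j V) ^+ 2.
    apply: eq_bigr => i _; apply: eq_bigr => j _; rewrite -expr2 mxE.
    by congr (_ ^+ 2); apply: eq_bigr => k _; rewrite big_ord1 !mxE.
  apply: (@le_trans _ _ (\sum_i \sum_j
      dot (row i M)^T (row i M)^T * dot (col j V) (col j V))).
    by do 2![apply: ler_sum => ? _]; exact: dot_sqr_le.
  rewrite le_eqVlt; apply/orP; left; apply/eqP.
  under eq_bigr do rewrite -mulr_sumr; rewrite -mulr_suml.
  congr (_ * _).
    apply: eq_bigr => i _; apply: eq_bigr => k _.
    by rewrite big_ord1 !mxE.
  rewrite /dot exchange_big /= ; apply: eq_bigr => k _.
  by apply: eq_bigr => j _; rewrite big_ord1 !mxE.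
have v0 := dotvv_ge0 V; have m0 := dotvv_ge0 M.
have := dotvv_ge0 (V - M *m V).
rewrite !dotE (dotC _ V); nra.
Qed.

End Dot.

(** * Spectral norm and Rayleigh quotients of Gram matrices *)

Section SpectralNorm.
Context {R : realType}.

Lemma dotvv_gt0 p q (A : 'M[R]_(p, q)) : A != 0 -> 0 < dot A A.
Proof.
move=> A0; rewrite lt_def dotvv_ge0 andbT.
by apply: contraNneq A0 => /dotvv_eq0 ->.
Qed.

(** [eigenvalue] speaks of row vectors; as the Gram matrix is symmetric, the transpose of a left
    eigenvector is a right one. *)
Lemma gram_eigenvalueP p q (M : 'M[R]_(p, q)) a :
  eigenvalue (M^T *m M) a ->
  exists2 u : 'cV[R]_q, u != 0 & dot (M *m u) (M *m u) = a * dot u u.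
Proof.
move=> /eigenvalueP[v vM v0]; exists v^T; first by rewrite trmx_eq0.
rewrite dot_mull mulmxA.
have -> : M^T *m M *m v^T = a *: v^T.
  by rewrite -linearZ /= -vM !trmx_mul trmxK.
by rewrite dotZr.
Qed.

Lemma gram_eigenvalues_le p q (M : 'M[R]_(p, q)) (c : R) :
  (forall u : 'cV[R]_q, dot (M *m u) (M *m u) <= c * dot u u) ->
  ubound [set a : R | eigenvalue (M^T *m M) a] c.
Proof.
move=> Mc a /gram_eigenvalueP[u u0 Mu].
by have := Mc u; rewrite Mu ler_pM2r // dotvv_gt0.
Qed.

Lemma spec_norm_ge0 p q (M : 'M[R]_(p, q)) : 0 <= spec_norm M.
Proof. exact: sqrtr_ge0. Qed.

Lemma spec_norm_le p q (M : 'M[R]_(p, q)) (c : R) : 0 <= c ->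
  (forall u : 'cV[R]_q, dot (M *m u) (M *m u) <= c ^+ 2 * dot u u) ->
  spec_norm M <= c.
Proof.
move=> c0 Mc; rewrite -[leRHS](ger0_norm c0) -sqrtr_sqr; apply: ler_wsqrtr.
(* A matrix without columns has no eigenvalue; the supremum of the empty set is then 0. *)
have [->|/set0P E0] := eqVneq [set a : R | eigenvalue (M^T *m M) a] set0.
  by rewrite sup0 sqr_ge0.
exact/(ge_sup E0)/gram_eigenvalues_le.
Qed.

(** Needed to undo the square root in [spec_norm], which sends negative numbers to 0. *)
Lemma gram_sup_eigenvalue_ge0 p q (M : 'M[R]_(p, q)) :
  0 <= sup [set a : R | eigenvalue (M^T *m M) a].
Proof.
set E := [set a : R | _].
have [->|/set0P[a Ea]] := eqVneq E set0; first by rewrite sup0.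
have [c _ Mc] := dot_mulmx_bounded 1 (M^T *m M).
have Eub : ubound E c.
  by apply: gram_eigenvalues_le => u; rewrite dot_mull mulmxA.
apply: (@le_trans _ _ a); last first.
  by apply: sup_upper_bound => //; split; [exists a|exists c].
have [u u0 Mu] := gram_eigenvalueP Ea.
by rewrite -(pmulr_lge0 _ (dotvv_gt0 u0)) -Mu dotvv_ge0.
Qed.

(* The infimum [mu] of the upper bounds of the Rayleigh quotient is itself an
   upper bound; were [mu - M^T M] invertible, Cauchy-Schwarz for this
   semidefinite form would bound it away from 0, contradicting minimality. *)
Lemma dot_gram_le_eigenvalue p q r (M : 'M[R]_(p, q)) (V0 : 'M[R]_(q, r)) :
  V0 != 0 -> exists2 mu : R, eigenvalue (M^T *m M) mu &
    forall V : 'M[R]_(q, r), dot (M *m V) (M *m V) <= mu * dot V V.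
Proof.
move=> V0n; set S := M^T *m M.
have SE (V : 'M[R]_(q, r)) : dot (M *m V) (M *m V) = dot V (S *m V).
  by rewrite dot_mull mulmxA.
pose Q := [set c : R | forall V : 'M[R]_(q, r), dot V (S *m V) <= c * dot V V].
have [c0 _ Qc0] := dot_mulmx_bounded r S.
have Qlb : lbound Q 0.
  move=> c /(_ V0) Vc; rewrite -(pmulr_lge0 _ (dotvv_gt0 V0n)).
  by apply: le_trans Vc; rewrite -SE dotvv_ge0.
have Qne : Q !=set0 by exists c0.
have Qmu (V : 'M[R]_(q, r)) : dot V (S *m V) <= inf Q * dot V V.
  have [->|Vn] := eqVneq V 0; first by rewrite mulmx0 !dot0r mulr0.
  rewrite -ler_pdivrMr ?dotvv_gt0 //; apply: lb_le_inf => // c /(_ V).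
  by rewrite ler_pdivrMr ?dotvv_gt0.
exists (inf Q); last by move=> V; rewrite SE.
have [//|] := boolP (eigenvalue S (inf Q)).
rewrite /eigenvalue /eigenspace negbK kermx_eq0 row_free_unit => Su.
pose T := (inf Q)%:M - S.
have Tu : T \in unitmx by rewrite -[T]opprB -scaleN1r unitmxZ ?unitrN1.
have TE (V : 'M[R]_(q, r)) : dot V (T *m V) = inf Q * dot V V - dot V (S *m V).
  by rewrite mulmxBl mul_scalar_mx dotDr dotNr dotZr.
have Tsym : T^T = T by rewrite linearB /= tr_scalar_mx trmx_mul trmxK.
have Tpos (V : 'M[R]_(q, r)) : 0 <= dot V (T *m V).
  by rewrite TE subr_ge0.
have [K K0 TK] := dot_mulmx_bounded r (invmx T).
have KV : 0 < K^-1 by rewrite invr_gt0.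
suff : Q (inf Q - K^-1).
  move=> /(ge_inf (ex_intro _ 0 Qlb)); lra.

move=> V; suff : K^-1 * dot V V <= dot V (T *m V) by rewrite TE; lra.
(* This reads |V|^4 <= <V, TV> <V, T^-1 V>, and the last factor is at most K |V|^2. *)
have := psd_sqr_le V (invmx T *m V) Tsym Tpos.
rewrite !(mulKVmx Tu) (dotC _ V) => H.
rewrite mulrC ler_pdivrMr //.
have [V00|Vn] := eqVneq V 0.
  by rewrite V00 mulmx0 !dot0r mul0r.
rewrite -(ler_pM2r (dotvv_gt0 Vn)) -expr2 (le_trans H) //.
by rewrite -mulrA ler_wpM2l.
Qed.

(** The best Rayleigh bound is an eigenvalue, hence at most the supremum. V may have several
    columns, so feature matrices are handled whole. *)
Lemma spec_norm_dot_le p q r (M : 'M[R]_(p, q)) (V : 'M[R]_(q, r)) :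
  dot (M *m V) (M *m V) <= spec_norm M ^+ 2 * dot V V.
Proof.
have [->|Vn] := eqVneq V 0; first by rewrite mulmx0 !dot0r mulr0.
rewrite sqr_sqrtr ?gram_sup_eigenvalue_ge0 //.
have [mu Emu Hmu] := dot_gram_le_eigenvalue M Vn.
apply: le_trans (Hmu V) _; rewrite ler_wpM2r ?dotvv_ge0 //.
apply: sup_upper_bound => //; split; first by exists mu.
have [c _ Mc] := dot_mulmx_bounded 1 (M^T *m M).
by exists c; apply: gram_eigenvalues_le => u; rewrite dot_mull mulmxA.
Qed.

(** By Cauchy-Schwarz, |M^T W|^4 = <W, M M^T W>^2 <= |W|^2 c |M^T W|^2; divide by |M^T W|^2. *)
Lemma op_bound_trmx p q r (M : 'M[R]_(p, q)) (c : R) : 0 <= c ->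
  (forall V : 'M[R]_(q, r), dot (M *m V) (M *m V) <= c * dot V V) ->
  forall W : 'M[R]_(p, r), dot (M^T *m W) (M^T *m W) <= c * dot W W.
Proof.
move=> c0 Mc W; have [->|Wn] := eqVneq (M^T *m W) 0.
  by rewrite dot0r mulr_ge0 ?dotvv_ge0.
rewrite -(ler_pM2r (dotvv_gt0 Wn)) -expr2 {1}dot_mull trmxK.
apply: le_trans (dot_sqr_le _ _) _; rewrite mulrAC mulrC.
by rewrite ler_wpM2r ?dotvv_ge0.
Qed.

Lemma dot_trmx_le_spec_norm p q r (M : 'M[R]_(p, q)) (W : 'M[R]_(p, r)) :
  dot (M^T *m W) (M^T *m W) <= spec_norm (M *m M^T) * dot W W.
Proof.
rewrite -ler_sqr ?nnegrE ?mulr_ge0 ?dotvv_ge0 ?spec_norm_ge0 //.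
rewrite {1}dot_mull trmxK mulmxA (le_trans (dot_sqr_le _ _)) // exprMn.
by rewrite (expr2 (dot W W)) [leRHS]mulrCA ler_wpM2l ?dotvv_ge0 ?spec_norm_dot_le.
Qed.

(** Here c bounds the squared norm of M, hence also that of M^T, so the composite has norm at most
    c. *)
Lemma spec_norm_gram_le p q (M : 'M[R]_(p, q)) (c : R) : 0 <= c ->
  (forall u : 'cV[R]_q, dot (M *m u) (M *m u) <= c * dot u u) ->
  spec_norm (M^T *m M) <= c.
Proof.
move=> c0 Mc; apply: spec_norm_le => // u; rewrite -mulmxA.
apply: le_trans (op_bound_trmx c0 Mc _) _.
by rewrite expr2 -mulrA ler_wpM2l.
Qed.

(** One inequality, proved for every matrix, is applied to M and to M^T. *)
Lemma spec_norm_gramC p q (M : 'M[R]_(p, q)) :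
  spec_norm (M^T *m M) = spec_norm (M *m M^T).
Proof.
have le p' q' (N : 'M[R]_(p', q')) :
    spec_norm (N^T *m N) <= spec_norm (N *m N^T).
  apply: spec_norm_gram_le (spec_norm_ge0 _) _ => u.
  rewrite -{1 2}[N]trmxK; apply: op_bound_trmx (spec_norm_ge0 _) _ _ => W.
  exact: dot_trmx_le_spec_norm.
by apply/eqP; rewrite eq_le le; have := le _ _ M^T; rewrite trmxK.
Qed.

End SpectralNorm.

(** * The normalized Laplacian as a Gram matrix, and its norm *)

Section GraphLaplacian.
Context {R : realType} {n m : nat} (e : 'I_m -> 'I_n * 'I_n).

Definition degmx : 'M[R]_n := \matrix_(i, j) (if i == j then deghat R e i else 0).

Lemma Ahat_sym i j : Ahat R e i j = Ahat R e j i.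
Proof.
rewrite !mxE (eq_sym j i).
by under eq_existsb do rewrite orbC.
Qed.

Lemma Ahat_ge0 i j : 0 <= Ahat R e i j.
Proof. by rewrite !mxE addr_ge0 //; case: ifP. Qed.

(** The added self-loop contributes 1, so even an isolated vertex has an invertible degree. *)
Lemma deghat_gt0 i : 0 < deghat R e i.
Proof.
rewrite /deghat (bigD1 i) //= ltr_pwDl ?sumr_ge0 //; last first.
  by move=> j _; exact: Ahat_ge0.
by rewrite !mxE eqxx /= ltr_wpDl //; case: ifP.
Qed.

Lemma Dhat_isqrt_sym : (Dhat_isqrt R e)^T = Dhat_isqrt R e.
Proof.
by apply/matrixP => i j; rewrite !mxE eq_sym; case: eqP => // ->.
Qed.

Lemma Dhat_isqrtE p (M : 'M[R]_(n, p)) i j :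
  (Dhat_isqrt R e *m M) i j = (Num.sqrt (deghat R e i))^-1 * M i j.
Proof.
rewrite mxE (bigD1 i) //= mxE eqxx big1 ?addr0 // => k ki.
by rewrite mxE eq_sym (negPf ki) mul0r.
Qed.

Lemma isqrt_degmx : Dhat_isqrt R e *m degmx *m Dhat_isqrt R e = 1%:M.
Proof.
apply/matrixP => i j.
rewrite -mulmxA Dhat_isqrtE -[degmx *m _]trmxK mxE trmx_mul Dhat_isqrt_sym.
rewrite Dhat_isqrtE !mxE; case: eqP => [->|]; last by rewrite !mulr0.
have d0 := deghat_gt0 j; rewrite mulrA -expr2 exprVn sqr_sqrtr ?(ltW d0) //.
by rewrite mulVf // gt_eqF.
Qed.

Lemma incid_row_sum l : \sum_j incid R e l j = 0.
Proof.
under eq_bigr do rewrite mxE; rewrite sumrB -!big_mkcond /=.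
by rewrite !big_pred1_eq subrr.
Qed.

Hypothesis he : simple_edges e.

(** An edge is not a loop, so its row has one +1 and one -1, at its two endpoints; a product over
    distinct columns is nonzero only when these are the endpoints. *)
Lemma incid_mul_offdiag l i j : i != j ->
  incid R e l i * incid R e l j =
  - ((e l == (i, j)) || (e l == (j, i)))%:R.
Proof.
case: he => /(_ l) el _ ij; rewrite !mxE; move: el.
case: (e l) => a b /= ab; rewrite !xpair_eqE.
have [ib|ib] := eqVneq i b; have [jb|jb] := eqVneq j b;
  have [ia|ia] := eqVneq i a; have [ja|ja] := eqVneq j a => //=; subst;
  rewrite ?eqxx ?(eq_sym a) ?(eq_sym b) ?ia ?ib ?ja ?jb ?(negPf ab) //=;
  rewrite ?eqxx in ab ij *;
  rewrite ?(negPf ia) ?(negPf ib) ?(negPf ja) ?(negPf jb) ?eqxx ?andbF //=;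
  try by []; ring.
Qed.

(** At most one edge joins i and j, in either orientation, so the sum over edges has at most one
    nonzero term. *)
Lemma incid_gram_offdiag i j : i != j ->
  ((incid R e)^T *m incid R e) i j = - Ahat R e i j.
Proof.
move=> ij; rewrite !mxE (negPf ij) addr0.
under eq_bigr do rewrite mxE incid_mul_offdiag //.
rewrite sumrN; congr (- _); case: existsP => [[l0 el0]|noe].
  rewrite (bigD1 l0) //= el0 big1 ?addr0 // => l ll0.
  have [_ /(_ l0 l)] := he; rewrite eq_sym => /(_ ll0)[].
  by case/orP: el0 => /eqP -> /= /negPf nE /negPf nE'; rewrite nE nE'.
rewrite big1 // => l _; rewrite (_ : _ || _ = false) //.
by apply/negP => el; case: noe; exists l.
Qed.

Lemma incid_gram : (incid R e)^T *m incid R e = degmx - Ahat R e.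
Proof.
(* Both sides have zero row sums, so the diagonal follows from the rest. *)
have off i j : i != j ->
    ((incid R e)^T *m incid R e) i j = (degmx - Ahat R e) i j.
  by move=> ij; rewrite incid_gram_offdiag // [RHS]mxE !mxE (negPf ij) add0r.
apply/matrixP => i j; have [<-|] := eqVneq i j; last exact: off.
have r1 : \sum_j ((incid R e)^T *m incid R e) i j = 0.
  under eq_bigr do rewrite mxE; rewrite exchange_big big1 // => l _ /=.
  by rewrite -mulr_sumr incid_row_sum mulr0.
have r2 : \sum_j (degmx - Ahat R e) i j = 0.
  rewrite (eq_bigr (fun j => degmx i j - Ahat R e i j)); last first.
    by move=> k _; rewrite [LHS]mxE [X in _ + X]mxE.
  rewrite sumrB [X in _ - X]/(deghat R e i) (bigD1 i) //= mxE eqxx.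
  by rewrite big1 ?addr0 ?subrr // => k ki; rewrite mxE eq_sym (negPf ki).
move: (etrans r1 (esym r2)); rewrite (bigD1 i) //= [RHS](bigD1 i) //=.
under eq_bigr => k ki do rewrite off 1?eq_sym //.
exact: addIr.
Qed.

(** The self-loops cancel in [degmx - Ahat], which is therefore the Gram matrix of the incidence
    matrix; conjugation by D^(-1/2) turns its degree part into the identity. *)
Lemma Ltilde_gram : Ltilde R e = (Dtilde R e)^T *m Dtilde R e.
Proof.
rewrite /Dtilde trmx_mul Dhat_isqrt_sym mulmxA -[_ *m _ *m incid R e]mulmxA.
by rewrite incid_gram mulmxBr mulmxBl isqrt_degmx.
Qed.

(** With w = D^(-1/2) u, the gap 2|u|^2 - |Bu|^2 equals half the sum of Ahat_ij (w_i + w_j)^2, a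
    signless Laplacian form. *)
Lemma dot_Dtilde_le (u : 'cV[R]_n) :
  dot (Dtilde R e *m u) (Dtilde R e *m u) <= 2 * dot u u.
Proof.
pose w := Dhat_isqrt R e *m u.
have duu : dot u u = \sum_i \sum_j Ahat R e i j * w i 0 ^+ 2.
  apply: eq_bigr => i _; rewrite -mulr_suml big_ord1 Dhat_isqrtE exprMn exprVn.
  rewrite sqr_sqrtr ?(ltW (deghat_gt0 i)) // mulrA divff ?mul1r //.
  by rewrite gt_eqF // deghat_gt0.
have duu' : dot u u = \sum_i \sum_j Ahat R e i j * w j 0 ^+ 2.
  rewrite duu exchange_big /=; apply: eq_bigr => i _; apply: eq_bigr => j _.
  by rewrite Ahat_sym.
have -> : dot (Dtilde R e *m u) (Dtilde R e *m u) =
          dot u u - \sum_i \sum_j Ahat R e i j * (w i 0 * w j 0).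
  rewrite dot_mull mulmxA -Ltilde_gram mulmxBl mul1mx dotDr dotNr; congr (_ - _).
  rewrite dotC /Atilde -!mulmxA dot_mull Dhat_isqrt_sym dotC.
  apply: eq_bigr => i _; rewrite big_ord1 [X in _ * X]mxE mulr_sumr.
  by apply: eq_bigr => j _; ring.
suff : 0 <= \sum_i \sum_j Ahat R e i j * (w i 0 + w j 0) ^+ 2.
  suff -> : \sum_i \sum_j Ahat R e i j * (w i 0 + w j 0) ^+ 2 = dot u u + dot u u
    + 2 * \sum_i \sum_j Ahat R e i j * (w i 0 * w j 0) by lra.
  rewrite {1}duu duu' mulr_sumr -!big_split /=; apply: eq_bigr => i _.
  by rewrite mulr_sumr -!big_split /=; apply: eq_bigr => j _; ring.
by do 2![apply: sumr_ge0 => ? _]; rewrite mulr_ge0 ?sqr_ge0 ?Ahat_ge0.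
Qed.

End GraphLaplacian.

(** * The two penalties, their dual balls and the projections onto them *)

Section Regularizer.
Context {R : realType}.
Implicit Types (lam : R) (o : option_kind).

Lemma dot_rows p q (A B : 'M[R]_(p, q)) :
  dot A B = \sum_i dot (row i A) (row i B).
Proof.
apply: eq_bigr => i _; rewrite /dot big_ord1.
by apply: eq_bigr => j _; rewrite !mxE.
Qed.

Lemma row_norm_ge0 p q (A : 'M[R]_(p, q)) i : 0 <= row_norm A i.
Proof. exact: sqrtr_ge0. Qed.

Lemma row_normE p q (A : 'M[R]_(p, q)) i :
  row_norm A i = Num.sqrt (dot (row i A) (row i A)).
Proof.
rewrite /dot big_ord1; congr Num.sqrt; apply: eq_bigr => j _.
by rewrite !mxE expr2.
Qed.

Lemma sqr_row_norm p q (A : 'M[R]_(p, q)) i :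
  row_norm A i ^+ 2 = dot (row i A) (row i A).
Proof. by rewrite row_normE sqr_sqrtr ?dotvv_ge0. Qed.

Lemma row_normZ p q (A B : 'M[R]_(p, q)) i c :
  row i A = c *: row i B -> row_norm A i = `|c| * row_norm B i.
Proof.
move=> AB; rewrite !row_normE AB dotZl dotZr mulrA -expr2.
by rewrite sqrtrM ?sqr_ge0 // sqrtr_sqr.
Qed.

Lemma dot_row_le p q (A B : 'M[R]_(p, q)) i :
  dot (row i A) (row i B) <= row_norm A i * row_norm B i.
Proof.
rewrite !row_normE -sqrtrM ?dotvv_ge0 // (le_trans (ler_norm _)) //.
by rewrite -sqrtr_sqr ler_wsqrtr // dot_sqr_le.
Qed.

Definition reg lam o p q (W : 'M[R]_(p, q)) : R :=
  match o with OptI => lam * norm1 W | OptII => lam * norm21 W end.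

(* The domain of the conjugate of [reg], i.e. its dual unit ball. *)
Definition dual_ball lam o p q (Z : 'M[R]_(p, q)) : Prop :=
  forall W, dot W Z <= reg lam o W.

Lemma dual_ballI lam p q (Z : 'M[R]_(p, q)) :
  (forall i j, `|Z i j| <= lam) -> dual_ball lam OptI Z.
Proof.
move=> Zl W /=; rewrite mulr_sumr; apply: ler_sum => i _.
rewrite mulr_sumr; apply: ler_sum => j _.
by rewrite (le_trans (ler_norm _)) // normrM mulrC ler_wpM2r.
Qed.

Lemma dual_ballII lam p q (Z : 'M[R]_(p, q)) :
  (forall i, row_norm Z i <= lam) -> dual_ball lam OptII Z.
Proof.
move=> Zl W /=; rewrite dot_rows mulr_sumr; apply: ler_sum => i _.
by rewrite (le_trans (dot_row_le _ _ _)) // mulrC ler_wpM2r ?row_norm_ge0.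
Qed.

(** The maximizer is a subgradient: lam times the signs of W, or the rows of W rescaled to length
    lam. *)
Lemma reg_attained lam o p q (W : 'M[R]_(p, q)) : 0 <= lam ->
  exists2 Z, dual_ball lam o Z & dot W Z = reg lam o W.
Proof.
move=> l0; case: o.
  exists (\matrix_(i, j) (lam * Num.sg (W i j))).
    apply: dual_ballI => i j; rewrite mxE normrM (ger0_norm l0).
    by rewrite normr_sg; case: eqP => _; rewrite ?mulr1 ?mulr0.
  rewrite /= mulr_sumr; apply: eq_bigr => i _; rewrite mulr_sumr.
  by apply: eq_bigr => j _; rewrite mxE mulrCA [W i j * _]mulrC -normrEsg.
(* A zero row of W yields a zero row of Z, since the inverse of 0 is 0. *)
pose Z := \matrix_(i, j) (lam / row_norm W i * W i j).
have Zrow i : row i Z = (lam / row_norm W i) *: row i W.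
  by apply/rowP => j; rewrite !mxE.
exists Z.
  apply: dual_ballII => i; rewrite (row_normZ (Zrow i)).
  rewrite ger0_norm ?divr_ge0 ?row_norm_ge0 //.
  have [->|W0] := eqVneq (row_norm W i) 0; first by rewrite mulr0.
  by rewrite mulfVK.
rewrite /= mulr_sumr dot_rows; apply: eq_bigr => i _.
rewrite Zrow dotZr -sqr_row_norm.
have [->|W0] := eqVneq (row_norm W i) 0; first by rewrite expr0n !mulr0.
by rewrite expr2 mulrA mulfVK.
Qed.

(** Division by zero returns 0, so the case distinction of [prox] disappears. *)
Lemma row_proxII lam p q (W : 'M[R]_(p, q)) i :
  row i (prox lam OptII W) =
  (Num.min (row_norm W i) lam / row_norm W i) *: row i W.
Proof.
apply/rowP => j; rewrite !mxE; have [->|_] := eqVneq (row_norm W i) 0.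
  by rewrite invr0 mulr0 mul0r.
by rewrite mulrCA mulrC mulrAC.
Qed.

Lemma prox_dual_ball lam o p q (W : 'M[R]_(p, q)) : 0 <= lam ->
  dual_ball lam o (prox lam o W).
Proof.
move=> l0; case: o.
  apply: dual_ballI => i j; rewrite mxE normrM normr_sg.
  have m0 : 0 <= Num.min `|W i j| lam by rewrite le_min normr_ge0.
  rewrite (ger0_norm m0); case: eqP => _; first by rewrite mul0r.
  by rewrite mul1r ge_min lexx orbT.
apply: dual_ballII => i; rewrite (row_normZ (row_proxII _ _ _)).
have m0 : 0 <= Num.min (row_norm W i) lam by rewrite le_min row_norm_ge0.
rewrite ger0_norm ?divr_ge0 ?row_norm_ge0 //.
have [->|W0] := eqVneq (row_norm W i) 0; first by rewrite mulr0.
by rewrite mulfVK // ge_min lexx orbT.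
Qed.

(** Where clipping changes an entry (or row) of W, the clipped value has modulus lam and the
    direction of the excess; elsewhere the excess is 0. *)
Lemma reg_sub_prox lam o p q (W : 'M[R]_(p, q)) : 0 <= lam ->
  reg lam o (W - prox lam o W) = dot (W - prox lam o W) (prox lam o W).
Proof.
move=> l0; case: o => /=.
  rewrite mulr_sumr; apply: eq_bigr => i _; rewrite mulr_sumr.
  apply: eq_bigr => j _; rewrite !mxE.
  have [w0|w0|->] := ltrgt0P (W i j); last by rewrite sgr0 mul0r subr0 normr0 mulr0 mul0r.
    rewrite gtr0_sg // mul1r; case: (leP (W i j) lam) => wl.
      by rewrite subrr normr0 mulr0 mul0r.
    by rewrite gtr0_norm ?subr_gt0 // mulrC.
  rewrite ltr0_sg // mulN1r opprK; case: (leP (- W i j) lam) => wl.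
    by rewrite subrr normr0 mulr0 mul0r.
  by rewrite ltr0_norm; [ring | lra].
rewrite mulr_sumr dot_rows; apply: eq_bigr => i _.
set r := row_norm W i; set c := Num.min r lam / r.
have Prow : row i (prox lam OptII W) = c *: row i W by rewrite row_proxII.
have Drow : row i (W - prox lam OptII W) = (1 - c) *: row i W.
  by rewrite linearB /= Prow scalerBl scale1r.
rewrite (row_normZ Drow) Drow Prow dotZr dotZl -sqr_row_norm -/r.
have r0 : 0 <= r by exact: row_norm_ge0.
have [->|rn] := eqVneq r 0; first by rewrite expr0n !mulr0.
rewrite /c; case: (leP r lam) => rl.
  by rewrite divff // subrr normr0 !(mulr0, mul0r).
have rp : 0 < r by rewrite lt_def rn.
rewrite ger0_norm; first by field.
by rewrite subr_ge0 ler_pdivrMr // mul1r ltW.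
Qed.

(** The obtuse-angle property of a projection: [prox] attains the maximum of <W - prox W, .> over
    the dual ball. *)
Lemma prox_variational lam o p q (W Z : 'M[R]_(p, q)) : 0 <= lam ->
  dual_ball lam o Z -> dot (W - prox lam o W) (Z - prox lam o W) <= 0.
Proof.
by move=> l0 /(_ (W - prox lam o W)); rewrite reg_sub_prox // dotDr dotNr subr_le0.
Qed.

End Regularizer.

(** * Compactness and convexity of the dual ball *)

Section DualBallCompact.
Context {R : realType}.

Lemma continuous_dot (T : topologicalType) p q (F G : T -> 'M[R]_(p, q)) :
  (forall i j, continuous (fun t => F t i j)) ->
  (forall i j, continuous (fun t => G t i j)) ->
  continuous (fun t => dot (F t) (G t)).
Proof.
move=> Fc Gc; apply: continuous_big; first exact: add_continuous.
move=> i _; apply: continuous_big; first exact: add_continuous.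
by move=> j _ t; apply: cvgM; [exact: Fc|exact: Gc].
Qed.

Lemma continuous_mulmx_entry (T : topologicalType) p q r (M : 'M[R]_(p, q))
    (F : T -> 'M[R]_(q, r)) :
  (forall i j, continuous (fun t => F t i j)) ->
  forall i j, continuous (fun t => (M *m F t) i j).
Proof.
move=> Fc i j; under eq_fun do rewrite mxE.
apply: continuous_big; first exact: add_continuous.
by move=> k _ t; apply: cvgM; [exact: cvg_cst|exact: Fc].
Qed.

Lemma continuous_vec_mx_entry p q i j :
  continuous (fun v : 'rV[R]_(p * q) => vec_mx v i j).
Proof.
by move=> v; under eq_fun do rewrite mxE; exact: coord_continuous.
Qed.

Lemma dot_delta_mx p q (Z : 'M[R]_(p, q)) i j : dot (delta_mx i j) Z = Z i j.
Proof.
rewrite /dot (bigD1 i) //= (bigD1 j) //= mxE !eqxx mul1r !big1 ?addr0 //.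
  by move=> k /negPf ki; rewrite big1 // => l _; rewrite mxE ki mul0r.
by move=> l /negPf lj; rewrite mxE lj andbF mul0r.
Qed.

(** An intersection of closed half-spaces, contained in a box: testing against plus and minus the
    coordinate matrices D k bounds each entry. Flattening to row vectors makes the box a product of
    segments. *)
Lemma dual_ball_compact (lam : R) o p q :
  compact [set v : 'rV[R]_(p * q) | dual_ball lam o (vec_mx v)].
Proof.
pose D k : 'M[R]_(p, q) := vec_mx (delta_mx 0 k).
have vD (v : 'rV[R]_(p * q)) k : dot (D k) (vec_mx v) = v 0 k.
  rewrite /D; case/mxvec_indexP: k => i j.
  by rewrite vec_mx_delta dot_delta_mx mxE.
apply: (@subclosed_compact _ _ [set v : 'rV[R]_(p * q) |
    forall k, `[- reg lam o (- D k), reg lam o (D k)]%classic (v ord0 k)]).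
- rewrite (_ : mkset _ = \bigcap_W
      [set v | dot W (vec_mx v) <= reg lam o W]); last first.
    by apply/seteqP; split => [v vb W _|v vb W]; exact: vb.
  apply: closed_bigI => W _.
  have Wc : continuous (fun v : 'rV[R]_(p * q) => dot W (vec_mx v)).
    apply: continuous_dot => i j; first exact: cst_continuous.
    exact: continuous_vec_mx_entry.
  by apply: (preimage_closed _ (@closed_le R (reg lam o W))) => v _; exact: Wc.
- apply: (@rV_compact _ _ (fun k => `[- reg lam o (- D k), reg lam o (D k)]%classic)).
  by move=> k; exact: segment_compact.
- move=> v vb k; rewrite /= in_itv /= lerNl; apply/andP; split.
    by have := vb (- D k); rewrite dotNl vD.
  by have := vb (D k); rewrite vD.
Qed.

Lemma dual_ball_convex (lam : R) o p q (Z Z' : 'M[R]_(p, q)) t :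
  dual_ball lam o Z -> dual_ball lam o Z' -> 0 <= t <= 1 ->
  dual_ball lam o (Z + t *: (Z' - Z)).
Proof.
move=> bZ bZ' /andP[t0 t1] W; rewrite !dotE.
have := bZ W; have := bZ' W; nra.
Qed.

End DualBallCompact.

(** * Saddle points and the energy decrease *)

Section Saddle.
Context {R : realType} {n m d : nat}.
Variables (lam : R) (o : option_kind) (B : 'M[R]_(m, n)) (H : 'M[R]_n).
Variable X : 'M[R]_(n, d).
Hypotheses (lam0 : 0 <= lam) (Hsym : H^T = H).

(** Optimality conditions for 1/2 <x, Hx> - <x, X> + <Bx, z>, minimized in x and maximized over z in
    the dual ball. *)
Definition saddle (x : 'M[R]_(n, d)) (z : 'M[R]_(m, d)) :=
  [/\ dual_ball lam o z, H *m x = X - B^T *m z &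
      dot (B *m x) z = reg lam o (B *m x)].

Lemma unitmx_of_coercive : (forall v : 'cV[R]_n, dot v v <= dot v (H *m v)) ->
  H \in unitmx.
Proof.
move=> Hge; rewrite -row_free_unit -kermx_eq0; apply/rowV0P => v.
move=> /sub_kermxP vH; apply: trmx_inj; rewrite trmx0.
apply: dotvv_eq0; apply/eqP; rewrite eq_le dotvv_ge0 andbT.
apply: le_trans (Hge _) _.
by rewrite -Hsym -trmx_mul vH trmx0 dot0r.
Qed.

(* The dual variable minimizes [dot (X - B^T Z) (H^-1 (X - B^T Z))] over the
   compact dual ball; its first-order condition is the saddle-point condition. *)
Lemma saddle_exists : H \in unitmx -> exists x z, saddle x z.
Proof.
move=> Hu; pose A := invmx H; have Asym : A^T = A by rewrite trmx_inv Hsym.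
pose P (Z : 'M[R]_(m, d)) := X - B^T *m Z.
pose phi v := dot (P (vec_mx v)) (A *m P (vec_mx v)).
have phic : continuous phi.
  have Pc i j : continuous (fun v => P (vec_mx v) i j).
    move=> v; under eq_fun do rewrite mxE [X in _ + X]mxE.
    have := @continuous_mulmx_entry R _ n m d B^T vec_mx
      (@continuous_vec_mx_entry R m d) i j v.
    by move=> h; exact: (cvgB (cvg_cst (X i j)) h).
  by apply: continuous_dot => //; exact: continuous_mulmx_entry.
have [|v vb vmin] := compact_EVT_min _ (@dual_ball_compact R lam o m d)
    (continuous_subspaceT phic).
  have [Z Zb _] := reg_attained o (0 : 'M[R]_(m, d)) lam0.
  by exists (mxvec Z); rewrite /= mxvecK.
rewrite inE /= in vb; set z := vec_mx v in vb.
have zmin Z : dual_ball lam o Z -> dot (P z) (A *m P z) <= dot (P Z) (A *m P Z).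
  by move=> Zb; have := vmin (mxvec Z); rewrite inE /phi /= mxvecK; exact.
pose x := A *m P z; exists x, z; split=> //; first by rewrite mulKVmx.
have [Z Zb ZE] := reg_attained o (B *m x) lam0.
apply/eqP; rewrite eq_le vb /= -ZE -subr_ge0 -opprB oppr_ge0 -dotNr -dotDr.
rewrite leNgt; apply/negP; set D := Z - z; set a := dot _ _ => a0.
set b := dot (B^T *m D) (A *m (B^T *m D)).
have expand (Y U : 'M[R]_(n, d)) t : dot (Y - t *: U) (A *m (Y - t *: U)) =
    dot Y (A *m Y) - 2 * t * dot U (A *m Y) + t ^+ 2 * dot U (A *m U).
  have YU : dot Y (A *m U) = dot U (A *m Y) by rewrite dotC dot_mull Asym.
  rewrite mulmxBr -scalemxAr !dotE YU; ring.
have key t : 0 <= t <= 1 -> 2 * t * a <= t ^+ 2 * b.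
  move=> t01; have := zmin _ (dual_ball_convex vb Zb t01); rewrite -/D.
  have -> : P (z + t *: D) = P z - t *: (B^T *m D).
    by rewrite /P mulmxDr -scalemxAr opprD addrA.
  have aE : a = dot (B^T *m D) (A *m P z) by rewrite [RHS]dotC -dot_mull.
  rewrite expand -aE -/b; lra.
have s0 : 0 < a + `|b| by rewrite ltr_pwDl.
(* For this t one has t |b| < a, while [key] demands 2a <= t b. *)
have t01 : 0 <= a / (a + `|b|) <= 1.
  by rewrite divr_ge0 ?(ltW s0) ?(ltW a0) //= ler_pdivrMr // mul1r lerDl.
have := key _ t01; set t := a / _.
have tp : 0 < t by rewrite divr_gt0.
have ts : t * (a + `|b|) = a by rewrite mulfVK // gt_eqF.
have := ler_norm b; nra.
Qed.

(** The constant in X makes this equal to [objective], not merely equal up to a shift. *)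
Definition primal (F : 'M[R]_(n, d)) : R :=
  reg lam o (B *m F) + (1 / 2 * dot F (H *m F) - dot F X + 1 / 2 * dot X X).

(** Replacing the penalty by its minorant <BG, z>, exact at x, leaves a quadratic with zero gradient
    at x, so the excess is at least 1/2 <G - x, H(G - x)>. *)
Lemma primal_saddle x z : saddle x z ->
  (forall V : 'M[R]_(n, d), dot V V <= dot V (H *m V)) ->
  forall G, primal x + 1 / 2 * dot (G - x) (G - x) <= primal G.
Proof.
move=> [bz Hx ext] Hge G.
have bG := bz (B *m G).
have tr (F : 'M[R]_(n, d)) : dot (B *m F) z = dot F X - dot F (H *m x).
  by rewrite dot_mull Hx dotDr dotNr opprB addrC subrK.
have HC : dot x (H *m G) = dot G (H *m x) by rewrite [LHS]dotC dot_mull Hsym.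
have := Hge (G - x); rewrite mulmxBr /primal -ext.
move: bG; rewrite !tr !dotE HC (dotC x G); lra.
Qed.

Variables (gamma beta c : R).
Hypotheses (g0 : 0 < gamma) (b0 : 0 < beta).
Hypothesis dual_step : forall Z : 'M[R]_(m, d),
  3 * gamma * beta * dot (B^T *m Z) (B^T *m Z) <= 4 * dot Z Z.
(** Equivalently |V - gamma H V|^2 <= (1 - c) |V|^2: the gradient step contracts. *)
Hypothesis primal_step : forall V : 'M[R]_(n, d),
  gamma ^+ 2 * dot (H *m V) (H *m V) - 2 * gamma * dot V (H *m V)
    <= - c * dot V V.

(* The correction [- beta gamma^2 / 2] is what allows
   [gamma beta |B B^T|] to exceed 1. *)
Definition lyapunov (dx : 'M[R]_(n, d)) (dz : 'M[R]_(m, d)) : R :=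
  beta * dot dx dx + gamma * dot dz dz
    - beta * gamma ^+ 2 / 2 * dot (B^T *m dz) (B^T *m dz).

(** [dual_step] gives gamma |dz|^2 >= (3/4) beta gamma^2 |B^T dz|^2, more than the correction
    subtracts. *)
Lemma lyapunov_ge dx dz : beta * dot dx dx <= lyapunov dx dz.
Proof.
rewrite /lyapunov; have := dual_step dz.
have := dotvv_ge0 (B^T *m dz); set u := dot (B^T *m dz) _; set w := dot dz dz.
move=> u0 /(ler_wpM2l (ltW g0)) h.
have gbu : 0 <= beta * gamma ^+ 2 * u by rewrite !mulr_ge0 ?sqr_ge0 // ltW.
lra.
Qed.

Lemma lyapunov_decr xs zs x z y z' x' : saddle xs zs ->
  y = x - gamma *: (H *m x - X) ->
  z' = prox lam o (z + beta *: (B *m (y - gamma *: (B^T *m z)))) ->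
  x' = y - gamma *: (B^T *m z') ->
  lyapunov (x' - xs) (z' - zs) <=
    lyapunov (x - xs) (z - zs) - beta * c * dot (x - xs) (x - xs).
Proof.
move=> [bz Hx ext] yE; set w := z + _ => z'E x'E.
set dx := x - xs; set dz := z - zs; set dz' := z' - zs.
have dxE : x' - xs = dx - gamma *: (H *m dx) - gamma *: (B^T *m dz').
  rewrite x'E yE mulmxBr Hx mulmxBr !scalerBr.
  rewrite /dx; apply/matrixP => i j; rewrite !mxE; ring.
have wE : w - z' = dz - dz' + beta *: (B *m (x' - xs)) + beta *: (B *m xs)
    + beta *: (B *m (gamma *: (B^T *m (dz' - dz)))).
  have BE : B *m (y - gamma *: (B^T *m z)) = B *m (x' - xs) + B *m xs
      + B *m (gamma *: (B^T *m (dz' - dz))).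
    have -> : dz' - dz = z' - z by rewrite /dz /dz' opprB addrA subrK.
    by rewrite -!mulmxDr x'E subrK [B^T *m (_ - _)]mulmxBr scalerBr addrA subrK.
  rewrite /w BE /dz /dz' !scalerDr.
  by move: (B *m _) (B *m _) (B *m _) => *; apply/matrixP => i j; rewrite !mxE; ring.
(* Sum of two inequalities: the projection property tested at zs, and the maximality of zs at B xs
   tested at z'. *)
have mono : 0 <= dot (w - z') dz' - beta * dot (B *m xs) dz'.
  have h1 := prox_variational w lam0 bz; rewrite -z'E in h1.
  have h2 := prox_dual_ball o w lam0 (B *m xs); rewrite -z'E -ext in h2.
  have {}h2 : 0 <= - beta * dot (B *m xs) dz'.
    by rewrite mulNr oppr_ge0 pmulr_rle0 // /dz' dotDr dotNr subr_le0.
  have zE : zs - z' = - dz' by rewrite opprB.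
  move: h1; rewrite zE dotNr; lra.
clearbody dx dz dz'.
have g2 := ler_wpM2l (ltW b0) (primal_step dx).
(* With U = B^T dz and U' = B^T dz', adding 2 gamma times [mono] leaves, up to beta gamma^2, the
   term |U|^2/2 + |U'|^2/2 - 2<U, U'> = (3/4)|U' - U|^2 - (1/4)|U' + U|^2. The first square is
   absorbed by gamma |dz' - dz|^2, which is where 4/3 arises; the second is [g3]. *)
have g1 := ler_wpM2l (ltW g0) (dual_step (dz' - dz)).
have g3 := dotvv_ge0 (B^T *m dz' + B^T *m dz).
have {}g3 : 0 <= beta * gamma ^+ 2 * dot (B^T *m dz' + B^T *m dz) (B^T *m dz' + B^T *m dz).
  by rewrite mulr_ge0 // mulr_ge0 ?sqr_ge0 // ltW.
move: mono => /(mulr_ge0 (ltW g0)).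
rewrite wE !(dotDl, dotZl) !dot_mull dxE /lyapunov.
move: g1 g2 g3; rewrite mulmxBr !dotE.
move: (H *m dx) (B^T *m dz) (B^T *m dz') => P U U'.
rewrite (dotC P dx) (dotC U' dx) (dotC U' P) (dotC U' U) (dotC dz' dz).
lra.
Qed.

End Saddle.

(** * Convergence from a decreasing energy, and trace formulas *)

Lemma cvg0_of_sqr_decrease (R : realType) (u V : nat -> R) (a : R) :
  0 < a -> (forall k, 0 <= V k) ->
  (forall k, V k.+1 <= V k - a * u k ^+ 2) -> u @ \oo --> (0 : R).
Proof.
move=> a0 V0 Vdec.
have [l Vl] : exists l, V @ \oo --> (l : R).
  apply/cvg_ex; apply: nonincreasing_is_cvgn.
    apply/nonincreasing_seqP => k; apply: le_trans (Vdec k) _.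
    by rewrite gerBl mulr_ge0 ?sqr_ge0 // ltW.
  by exists 0 => _ [k _ <-].
(* V converges, so its consecutive differences tend to 0 and w squeezes u. *)
pose w k := Num.sqrt ((V k - V k.+1) / a).
have uw k : `|u k| <= w k.
  rewrite -sqrtr_sqr; apply: ler_wsqrtr; rewrite ler_pdivlMr //.
  by have := Vdec k; lra.
have w0 : w @ \oo --> (0 : R).
  rewrite -(@sqrtr0 R); apply: (continuous_cvg _ (@sqrt_continuous R 0)).
  rewrite -(mul0r a^-1) -(subrr l); apply: cvgM; last exact: cvg_cst.
  apply: cvgB => //; first by rewrite -(cvg_shiftS V) in Vl.
have wN0 : (- w) @ \oo --> (0 : R) by rewrite -oppr0; exact: cvgN.
apply: (squeeze_cvgr _ wN0 w0); near=> k.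
by rewrite -ler_norml uw.
Unshelve. all: by end_near. Qed.

Lemma mxtrace_dot (R : realType) p q (A B : 'M[R]_(p, q)) :
  \tr (A^T *m B) = dot A B.
Proof.
rewrite /mxtrace /dot exchange_big; apply: eq_bigr => j _ /=; rewrite mxE.
by apply: eq_bigr => i _; rewrite mxE.
Qed.

Lemma sqr_frob_norm (R : realType) p q (A : 'M[R]_(p, q)) :
  frob_norm A ^+ 2 = dot A A.
Proof.
rewrite /frob_norm sqr_sqrtr; last by do 2![apply: sumr_ge0 => ? _]; exact: sqr_ge0.
by do 2![apply: eq_bigr => ? _]; rewrite expr2.
Qed.

(** * Application to the elastic message passing iteration *)

Section ElasticMessagePassing.
Context {R : realType} {n m d : nat} (e : 'I_m -> 'I_n * 'I_n).
Hypothesis he : simple_edges e.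
Variables (Xin : 'M[R]_(n, d)) (lam1 lam2 : R).
Hypotheses (hl1 : 0 <= lam1) (hl2 : 0 <= lam2).

Local Notation B := (Dtilde R e).
Local Notation L := (Ltilde R e).

Definition hessian : 'M[R]_n := 1%:M + lam2 *: L.
Local Notation H := hessian.

Lemma Ltilde_mulE p (V : 'M[R]_(n, p)) : L *m V = B^T *m (B *m V).
Proof. by rewrite Ltilde_gram // mulmxA. Qed.

Lemma hessian_mulE p (V : 'M[R]_(n, p)) : H *m V = V + lam2 *: (L *m V).
Proof. by rewrite mulmxDl mul1mx -scalemxAl. Qed.

Lemma hessian_sym : H^T = H.
Proof.
by rewrite /H linearD linearZ /= trmx1 Ltilde_gram // trmx_mul trmxK.
Qed.

Lemma dot_hessian p (V : 'M[R]_(n, p)) :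
  dot V (H *m V) = dot V V + lam2 * dot (B *m V) (B *m V).
Proof. by rewrite hessian_mulE dotDr dotZr Ltilde_mulE dot_mull. Qed.

Lemma hessian_coercive p (V : 'M[R]_(n, p)) : dot V V <= dot V (H *m V).
Proof. by rewrite dot_hessian lerDl mulr_ge0 ?dotvv_ge0. Qed.

Lemma objectiveE o F : objective e Xin lam1 lam2 o F = primal lam1 o B H Xin F.
Proof.
have -> : objective e Xin lam1 lam2 o F =
    reg lam1 o (B *m F) + fsmooth e Xin lam2 F by case: o.
congr (_ + _); rewrite /fsmooth -mulmxA mxtrace_dot sqr_frob_norm.
rewrite hessian_mulE !dotE (dotC Xin F); lra.
Qed.

(** Here y is Y^k, written as a gradient step through the Hessian, the form required by
    [lyapunov_decr]. *)
Lemma emp_iterS gamma beta o k :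
  let FZ := emp_iter e Xin lam1 lam2 gamma beta o k in
  let FZ' := emp_iter e Xin lam1 lam2 gamma beta o k.+1 in
  exists y, [/\ y = FZ.1 - gamma *: (H *m FZ.1 - Xin),
    FZ'.2 = prox lam1 o (FZ.2 + beta *: (B *m (y - gamma *: (B^T *m FZ.2)))) &
    FZ'.1 = y - gamma *: (B^T *m FZ'.2)].
Proof.
rewrite /=; case: (emp_iter e Xin lam1 lam2 gamma beta o k) => F Z.
exists (((1 - gamma)%:M - (gamma * lam2) *: L) *m F + gamma *: Xin).
split=> //; rewrite hessian_mulE mulmxBl mul_scalar_mx -scalemxAl.
by move: (L *m F) => LF; apply/matrixP => i j; rewrite !mxE; ring.
Qed.

Lemma spec_norm_Ltilde : spec_norm L = spec_norm (B *m B^T).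
Proof. by rewrite Ltilde_gram // spec_norm_gramC. Qed.

Variables (gamma beta : R).
Hypotheses (g0 : 0 < gamma) (b0 : 0 < beta).
(** Both step-size conditions are multiplied out, so that a zero norm needs no separate case. *)
Hypothesis hg : gamma * (1 + lam2 * spec_norm L) < 2.
Hypothesis hb : 3 * gamma * beta * spec_norm (B *m B^T) <= 4.

Lemma emp_dual_step (Z : 'M[R]_(m, d)) :
  3 * gamma * beta * dot (B^T *m Z) (B^T *m Z) <= 4 * dot Z Z.
Proof.
apply: le_trans (ler_wpM2r (dotvv_ge0 Z) hb); rewrite -[leRHS]mulrA.
by rewrite ler_wpM2l ?dot_trmx_le_spec_norm // !mulr_ge0 // ltW.
Qed.

(** Each eigenvalue h of H lies in [1, 1 + lam2 |L|], hence gamma h (2 - gamma h) >= gamma (2 -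
    gamma (1 + lam2 |L|)). Bounds between |V|^2, |BV|^2 and |LV|^2 replace diagonalization. *)
Lemma emp_primal_step (V : 'M[R]_(n, d)) :
  gamma ^+ 2 * dot (H *m V) (H *m V) - 2 * gamma * dot V (H *m V)
    <= - (gamma * (2 - gamma * (1 + lam2 * spec_norm L))) * dot V V.
Proof.
have hw := dot_trmx_le_spec_norm B (B *m V).
have hu := dot_trmx_le_spec_norm B^T V.
rewrite !trmxK -Ltilde_gram // in hu.
rewrite -spec_norm_Ltilde in hw.
have VL : dot V (L *m V) = dot (B *m V) (B *m V).
  by rewrite Ltilde_mulE [RHS]dot_mull.
rewrite dot_hessian hessian_mulE !dotE (dotC (L *m V) V) VL Ltilde_mulE.
move: hg hw hu (dotvv_ge0 (B *m V)).
move: (spec_norm L) (dot V V) (dot (B *m V) _) (dot (B^T *m _) _) => l v u w.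
move=> hl hw hu u0; have g2 : 0 <= gamma ^+ 2 := sqr_ge0 _.
(* The gap between the two sides is exactly the sum of the terms in [h1], [h2] and [h3]. *)
have h1 : 0 <= gamma ^+ 2 * (lam2 ^+ 2 * (l * u - w)).
  by do 2![apply: mulr_ge0; rewrite ?sqr_ge0 //]; rewrite subr_ge0.
have h2 : 0 <= gamma ^+ 2 * (lam2 * (l * v - u)).
  by do 2![apply: mulr_ge0 => //]; rewrite subr_ge0.
have h3 : 0 <= gamma * lam2 * u * (2 - gamma * (1 + lam2 * l)).
  by apply: mulr_ge0; [rewrite !mulr_ge0 // ltW|rewrite subr_ge0 ltW].
lra.
Qed.

Lemma emp_cvg_saddle o xs zs : saddle lam1 o B H Xin xs zs ->
  forall i j, (fun k => emp_F e Xin lam1 lam2 gamma beta o k i j) @ \oo --> xs i j.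
Proof.
move=> sxz i j; pose F := emp_F e Xin lam1 lam2 gamma beta o.
pose Z k := (emp_iter e Xin lam1 lam2 gamma beta o k).2.
pose c := gamma * (2 - gamma * (1 + lam2 * spec_norm L)).
have c0 : 0 < c by rewrite mulr_gt0 // subr_gt0.
pose V k := lyapunov B gamma beta (F k - xs) (Z k - zs).
have V0 k : 0 <= V k.
  apply: le_trans (lyapunov_ge g0 b0 emp_dual_step _ _).
  by rewrite mulr_ge0 ?dotvv_ge0 // ltW.
have Vdec k : V k.+1 <= V k - beta * c * (F k - xs) i j ^+ 2.
  have [y [yE zE xE]] := emp_iterS gamma beta o k.
  have := lyapunov_decr hl1 g0 b0 emp_dual_step emp_primal_step sxz yE zE xE.
  move/le_trans; apply; rewrite lerD2l lerN2 ler_wpM2l ?sqr_entry_le_dot //.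
  by rewrite mulr_ge0 // ltW.
have := cvg0_of_sqr_decrease (mulr_gt0 b0 c0) V0 Vdec.
move/(cvgD (cvg_cst (xs i j))); rewrite addr0; apply: cvg_trans.
apply: near_eq_cvg; near=> k.
by rewrite /= [in LHS]/GRing.add /= !mxE addrC subrK.
Unshelve. all: by end_near. Qed.

End ElasticMessagePassing.

Theorem theorem1 (R : realType) (n m : nat) (e : 'I_m -> 'I_n * 'I_n)
  (he : simple_edges e) (d : nat) (Xin : 'M[R]_(n, d)) (lam1 lam2 : R)
  (hl1 : 0 <= lam1) (hl2 : 0 <= lam2) :
  [/\ spec_norm (Ltilde R e) = spec_norm ((Dtilde R e)^T *m Dtilde R e),
      spec_norm ((Dtilde R e)^T *m Dtilde R e) = spec_norm (Dtilde R e *m (Dtilde R e)^T),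
      spec_norm (Dtilde R e *m (Dtilde R e)^T) <= 2 &
      forall (gamma beta : R), 0 < gamma -> 0 < beta ->
        gamma * (1 + lam2 * spec_norm (Ltilde R e)) < 2 ->
        3 * gamma * beta * spec_norm (Dtilde R e *m (Dtilde R e)^T) <= 4 ->
        forall o : option_kind,
          (exists Fs : 'M[R]_(n, d), forall G, objective e Xin lam1 lam2 o Fs <= objective e Xin lam1 lam2 o G) /\
          (forall Fs : 'M[R]_(n, d),
             (forall G, objective e Xin lam1 lam2 o Fs <= objective e Xin lam1 lam2 o G) ->
             forall i j, (fun k => emp_F e Xin lam1 lam2 gamma beta o k i j) @ \oo --> Fs i j)].
Proof.
split; [by rewrite Ltilde_gram|exact: spec_norm_gramC| |].
  by rewrite -spec_norm_gramC spec_norm_gram_le // => u; exact: dot_Dtilde_le.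
move=> gamma beta g0 b0 hg hb o.
have Hu : hessian e lam2 \in unitmx.
  by apply: unitmx_of_coercive (hessian_sym he _) _ => v; exact: hessian_coercive.
have [xs [zs sxz]] := saddle_exists o (Dtilde R e) Xin hl1 (hessian_sym he _) Hu.
have opt := primal_saddle (hessian_sym he lam2) sxz (hessian_coercive he hl2 (p:=d)).
split.
  exists xs => G; rewrite !objectiveE //; apply: le_trans (opt G).
  by rewrite lerDl mulr_ge0 ?dotvv_ge0.
(* The quadratic growth in [opt] forces every minimizer to coincide with xs, the limit of the
   iterates. *)
move=> Fs Fsmin i j; suff -> : Fs = xs by apply: emp_cvg_saddle sxz i j.
apply/eqP; rewrite -subr_eq0; apply/eqP/dotvv_eq0.
have := Fsmin xs; rewrite !objectiveE // => le1; have le2 := opt Fs.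
have := dotvv_ge0 (Fs - xs); lra.
Qed.
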